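(* Let $v\geq 2$ and $1\leq i\leq v$ be integers and let $L,M\geq 0$ be integers. Then \[ \sum_{n_1,\ldots,n_{v-1}\geq 0} q^{\sum_{j=1}^{v-1}N_j^2}{2L+v-i+M-N_1 \brack M-N_1}_q{L-\sum_{t=1}^{v-2}N_t \brack n_{v-1}}_{q^2}\prod_{j=1}^{v-2}{n_j+2L-2\sum_{t=1}^{j}N_t+\min(v-i,v-1-j) \brack n_j}_q \] \[ =\sum_{j=-\infty}^{\infty}(-1)^jq^{vj^2}{L+M-(v-1)j \brack L-vj}_q{L+(v-i)+M+(v-1)j \brack L+(v-i)+vj}_q . \]
   Context: For integers $n\ge0$, $(q)_n=\prod_{j=1}^{n}(1-q^j)$. For integers $m,n$, ${n+m \brack n}_q=\frac{(q)_{n+m}}{(q)_n(q)_m}$ if $m,n\geq 0$ and $0$ otherwise; ${\cdot \brack \cdot}_{q^2}$ is the same with $q$ replaced by $q^2$. For summation variables $n_1,\ldots,n_{v-1}$, $N_j=\sum_{t=j}^{v-1}n_t$. Empty sums are $0$, empty products are $1$. *)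

(* Defs.v *)
From mathcomp Require Export all_boot all_order all_algebra.
From mathcomp Require Export boolp classical_sets cardinality fsbigop.
From mathcomp Require Import zify.

Set Implicit Arguments.
Unset Strict Implicit.
Unset Printing Implicit Defensive.

Import Order.TTheory GRing.Theory Num.Theory.
Local Open Scope classical_set_scope.
Local Open Scope ring_scope.

Definition qpoch (F : fieldType) (q : F) (n : nat) : F :=
  \prod_(1 <= j < n.+1) (1 - q ^+ j).

(* [qbinom q a b] is the q-binomial coefficient with upper entry [a] and lower
   entry [b]; it vanishes unless [b] and [a - b] are both nonnegative, so the
   absolute values are only ever taken of nonnegative integers. *)
Definition qbinom (F : fieldType) (q : F) (a b : int) : F :=
  if (0 <= b) && (0 <= a - b) then
    qpoch q `|a|%N / (qpoch q `|b|%N * qpoch q `|(a - b)%R|%N)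
  else 0.

(* A tuple (n_1, ..., n_(v-1)) is stored 0-based; [nsum] and [ncoord] use the
   1-based indices of the formulas. *)
Definition ncoord (v : nat) (n : v.-1.-tuple nat) (j : nat) : nat :=
  nth 0%N n j.-1.

Definition nsum (v : nat) (n : v.-1.-tuple nat) (j : nat) : nat :=
  (\sum_(j <= t < v) ncoord n t)%N.

Definition lhs_term (F : fieldType) (q : F) (v i L M : nat)
    (n : v.-1.-tuple nat) : F :=
  q ^+ (\sum_(1 <= j < v) nsum n j ^ 2)%N
  * qbinom q ((2 * L + (v - i) + M)%N%:Z - (nsum n 1)%:Z)
             (M%:Z - (nsum n 1)%:Z)
  * qbinom (q ^+ 2) (L%:Z - \sum_(1 <= t < v.-1) (nsum n t)%:Z)
             (ncoord n v.-1)%:Z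
  * \prod_(1 <= j < v.-1)
      qbinom q ((ncoord n j)%:Z + (2 * L)%N%:Z
                - 2 * (\sum_(1 <= t < j.+1) (nsum n t)%:Z)
                + (minn (v - i) (v - 1 - j))%:Z)
               (ncoord n j)%:Z.

Definition rhs_term (F : fieldType) (q : F) (v i L M : nat) (j : int) : F :=
  (-1) ^ j * q ^ (v%:Z * j ^+ 2)
  * qbinom q (L%:Z + M%:Z - (v%:Z - 1) * j) (L%:Z - v%:Z * j)
  * qbinom q (L%:Z + (v%:Z - i%:Z) + M%:Z + (v%:Z - 1) * j)
             (L%:Z + (v%:Z - i%:Z) + v%:Z * j).

(* The sums [\sum_(x \in A) f x] of [fsbigop] default to 0 when [f] has infinite
   support on [A]; the next two lemmas show that this never happens here. *)
Lemma finite_lhs_support (F : fieldType) (q : F) (v i L M : nat) :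
  finite_set [set n : v.-1.-tuple nat | lhs_term q i L M n != 0].
Proof.
pose h (x : {ffun 'I_v.-1 -> 'I_M.+1}) : v.-1.-tuple nat :=
  [tuple nat_of_ord (x k) | k < v.-1].
apply: (@sub_finite_set _ _ (h @` setT)); last exact/finite_image/finite_finset.
move=> n /= nz.
have leM : (nsum n 1 <= M)%N.
  rewrite leqNgt; apply/negP => ltM; move: nz; rewrite /lhs_term.
  by rewrite {1}/qbinom ifF ?mulr0 ?mul0r ?eqxx //; lia.
have len (k : 'I_v.-1) : (tnth n k < M.+1)%N.
  rewrite ltnS; apply: leq_trans leM; rewrite /nsum.
  have kv : (k.+1 < v)%N by have := ltn_ord k; lia.
  rewrite (tnth_nth 0%N) (bigD1_seq k.+1) ?iota_uniq ?mem_index_iota //=.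
  exact: leq_addr.
exists [ffun k => Ordinal (len k)] => //.
by apply: eq_from_tnth => k; rewrite tnth_mktuple ffunE.
Qed.

Lemma finite_rhs_support (F : fieldType) (q : F) (v i L M : nat) :
  (0 < v)%N -> finite_set [set j : int | rhs_term q v i L M j != 0].
Proof.
move=> v0.
pose h (x : 'I_(2 * L + 2 * v).+1) : int := x%:Z - (L + v)%N%:Z.
apply: (@sub_finite_set _ _ (h @` setT)); last exact/finite_image/finite_finset.
move=> j /= nz.
have h1 : 0 <= L%:Z - v%:Z * j.
  rewrite leNgt; apply/negP => lt0; move: nz; rewrite /rhs_term {1}/qbinom ifF.
    by rewrite mulr0 mul0r eqxx.
  by rewrite leNgt lt0.
have h2 : 0 <= L%:Z + (v%:Z - i%:Z) + v%:Z * j.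
  rewrite leNgt; apply/negP => lt0; move: nz.
  rewrite /rhs_term [X in _ * X]/qbinom ifF.
    by rewrite mulr0 eqxx.
  by rewrite leNgt lt0.
have lt : (`|(j + (L + v)%N%:Z)%R|%N < (2 * L + 2 * v).+1)%N by nia.
by exists (Ordinal lt) => //; rewrite /h /=; nia.
Qed.

(* The formal reading, in which [q] is an indeterminate, is an instance of the
   hypothesis made on [q]. *)
Lemma indeterminate_not_root_of_unity (K : fieldType) (k : nat) :
  (0 < k)%N -> tofrac ('X : {poly K}) ^+ k != 1.
Proof.
move=> k0; rewrite -rmorphXn -(rmorph1 (@tofrac {poly K})) /=.
rewrite tofrac_eq; apply/eqP => /(congr1 (fun p : {poly K} => size p)).
by rewrite size_polyXn size_poly1; case: k k0.
Qed.

(* Main.v *)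
Require Import Defs.
From mathcomp Require Import ring zify.

(* The right-hand side is stable under the Burge transform: writing
   R_{v,k}(L,M) for it with k = v - i, the q-Saalschutz sum gives
     sum_r q^(r^2) [2L+k+M-r, M-r] R_{v,k}(L-r,r) = R_{v+1,k}(L,M)  (k <= v).
   The left-hand side satisfies the same recursion in r = N_1, except that k is
   replaced by min(k, v-1) in the inner sum; this is harmless since
   R_{v,v} = R_{v,v-1}, the difference being antisymmetric under j -> -1-j.
   The induction starts at v = 1, k = 0, where (x;q)_n (-x;q)_n = (x^2;q^2)_n
   gives R_{1,0}(L,M) = [L+M, M]_{q^2}. *)

Set Implicit Arguments.
Unset Strict Implicit.
Unset Printing Implicit Defensive.

Import Order.TTheory GRing.Theory Num.Theory.
Local Open Scope classical_set_scope.
Local Open Scope ring_scope.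

(** * Truncating and shifting sums whose extra terms vanish *)

Lemma big_ord_widen_eq0 (V : zmodType) (m n : nat) (f : nat -> V) :
  (m <= n)%N -> (forall i, (m <= i < n)%N -> f i = 0) ->
  \sum_(i < n) f i = \sum_(i < m) f i.
Proof.
move=> le_mn f0; rewrite (big_ord_widen n f le_mn) [RHS]big_mkcond.
by apply: eq_bigr => i _; case: ifPn => // ?; apply: f0; have := ltn_ord i; lia.
Qed.

Lemma big_ord_shift_eq0 (V : zmodType) (K c : nat) (f : nat -> V) :
  (forall r, (r < c)%N -> f r = 0) -> (forall r, (K <= r)%N -> f r = 0) ->
  \sum_(x < K) f (x + c)%N = \sum_(r < K) f r.
Proof.
move=> f0 fK; rewrite -(@big_ord_widen_eq0 _ K (c + K)%N) ?leq_addl //.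
  rewrite big_split_ord /= [X in X + _]big1 => [|i _]; last exact/f0/ltn_ord.
  by rewrite add0r; apply: eq_bigr => i _; rewrite addnC.
by move=> i ?; apply: fK; lia.
Qed.

Lemma big_ord_geq (V : zmodType) (s m : nat) (g : nat -> V) : (s <= m)%N ->
  \sum_(t < m.+1 | (s <= t)%N) g (t - s)%N = \sum_(k < (m - s).+1) g k.
Proof.
move=> le_sm; rewrite big_mkcond.
have -> : m.+1 = (s + (m - s).+1)%N by lia.
rewrite big_split_ord /= [X in X + _]big1 => [|t _].
  by rewrite add0r; apply: eq_bigr => t _; rewrite leq_addr addKn.
by rewrite leqNgt ltn_ord.
Qed.

(** * Gaussian binomials: Pascal, Vandermonde and Saalschutz *)

Section QBinomial.
Variables (F : fieldType) (q : F).

Definition qbin (n k : nat) : F :=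
  if (k <= n)%N then qpoch q n / (qpoch q k * qpoch q (n - k)) else 0.

Lemma qbinomE (a b : int) :
  qbinom q a b = if (0 <= a) && (0 <= b) then qbin `|a|%N `|b|%N else 0.
Proof.
rewrite /qbinom /qbin; case: ifPn => [/andP[b0 ab0]|nab].
  have -> : (0 <= a) && (0 <= b) by lia.
  have -> : (`|b| <= `|a|)%N by lia.
  by have -> : `|(a - b)%R|%N = (`|a| - `|b|)%N by lia.
by case: ifP => // ab; rewrite ifF //; lia.
Qed.

Lemma qbinom_nat (n k : nat) : qbinom q n k = qbin n k.
Proof. by rewrite qbinomE /=. Qed.

Lemma qbinom_eq0 (a b : int) : (a < 0) || (b < 0) || (a < b) -> qbinom q a b = 0.
Proof. by move=> ab; rewrite /qbinom ifF //; lia. Qed.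

Lemma qbinom_sym (a b : int) : qbinom q a b = qbinom q a (a - b).
Proof.
rewrite /qbinom; have -> : a - (a - b) = b by lia.
by rewrite andbC [X in _ / X]mulrC.
Qed.

Lemma qbin_small (n k : nat) : (n < k)%N -> qbin n k = 0.
Proof. by rewrite /qbin; case: leqP. Qed.

Lemma qpoch0 : qpoch q 0 = 1.
Proof. by rewrite /qpoch big_nil. Qed.

Lemma qpochS n : qpoch q n.+1 = qpoch q n * (1 - q ^+ n.+1).
Proof. by rewrite /qpoch big_nat_recr. Qed.

Lemma qbin_sym n k : (k <= n)%N -> qbin n (n - k) = qbin n k.
Proof. move=> kn; rewrite /qbin leq_subr kn subKn //; congr (_ / _);
  exact: mulrC. Qed.

Hypothesis q_not_root : forall k : nat, (0 < k)%N -> q ^+ k != 1.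

Lemma oneB_expr_neq0 n : 1 - q ^+ n.+1 != 0.
Proof. by rewrite subr_eq0 eq_sym q_not_root. Qed.

Lemma qpoch_neq0 n : qpoch q n != 0.
Proof.
elim: n => [|n IH]; first by rewrite qpoch0 oner_neq0.
by rewrite qpochS mulf_neq0 ?oneB_expr_neq0.
Qed.

Lemma qbinn n : qbin n n = 1.
Proof. by rewrite /qbin leqnn subnn qpoch0 mulr1 divff ?qpoch_neq0. Qed.

Lemma qbin0 n : qbin n 0 = 1.
Proof. by rewrite -(qbin_sym (leq0n n)) subn0 qbinn. Qed.

Lemma qbinS n k : qbin n.+1 k.+1 = qbin n k.+1 + q ^+ (n - k) * qbin n k.
Proof.
case: (ltngtP k n) => [lt_kn|lt_nk|->]; last 2 first.
- by rewrite !qbin_small ?mulr0 ?addr0 //; lia.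
- by rewrite subnn !qbinn qbin_small // add0r mulr1.
have -> : n = ((n - k.+1) + k.+1)%N by rewrite subnK.
move: (n - k.+1)%N => d; rewrite /qbin !ifT; [|lia..].
have -> : ((d + k.+1).+1 - k.+1)%N = d.+1 by lia.
have -> : ((d + k.+1) - k.+1)%N = d by lia.
have -> : ((d + k.+1) - k)%N = d.+1 by lia.
have := qpoch_neq0 d; have := qpoch_neq0 k.
have := oneB_expr_neq0 d; have := oneB_expr_neq0 k.
rewrite !qpochS -addSn exprD => h1 h2 h3 h4.
by field; rewrite h1 h2 h3 h4.
Qed.

Lemma qbinS_sym n k : qbin n.+1 k.+1 = q ^+ k.+1 * qbin n k.+1 + qbin n k.
Proof.
have [lt_nk|le_kn] := ltnP n k; first by rewrite !qbin_small ?mulr0 ?addr0 //; lia.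
rewrite -(@qbin_sym n.+1) // subSS -(@qbin_sym n k) //.
move: le_kn; rewrite leq_eqVlt => /predU1P[->|lt_kn].
  by rewrite subnn !qbin0 qbin_small // mulr0 add0r.
rewrite -(@qbin_sym n k.+1) //; have -> : (n - k)%N = (n - k.+1).+1 by lia.
by rewrite qbinS addrC; congr (_ ^+ _ * _ + _); lia.
Qed.

(** At [a = b = 0] the left side is 1 and the right side 0, whence the exclusion. The absolute value
    is harmless: the last q-binomial vanishes when [a < b]. *)
Lemma qbinom_pascal (a b : int) : (a != 0) || (b != 0) ->
  qbinom q a b = qbinom q (a - 1) b + q ^+ `|a - b|%N * qbinom q (a - 1) (b - 1).
Proof.
case: (ltP b 0) => [b0 _|b0]; first by rewrite !qbinom_eq0 ?mulr0 ?addr0 //; lia.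
case: (ltP a 0) => [a0 _|a0]; first by rewrite !qbinom_eq0 ?mulr0 ?addr0 //; lia.
case: a a0 => // -[|n] _ /=; first by move=> ?; rewrite !qbinom_eq0 ?mulr0 ?addr0
  //; lia.
have -> : n.+1%:Z - 1 = n by lia.
case: b b0 => // -[|k] _ _.
  by rewrite [qbinom q n (_ - _)]qbinom_eq0 // mulr0 addr0 !qbinom_nat !qbin0.
have -> : k.+1%:Z - 1 = k by lia.
rewrite !qbinom_nat qbinS; congr (_ + _).
have [lt_nk|le_kn] := ltnP n k; first by rewrite !qbin_small ?mulr0 //.
by congr (_ ^+ _ * _); lia.
Qed.

(** Induction on [a] with Pascal's rule in the form [qbinS_sym]. The truncated difference [a - k] is
    harmless, since [qbin a k] vanishes for [k > a]. *)
Lemma qbin_vandermonde a b n :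
  qbin (a + b) n =
  \sum_(k < n.+1) q ^+ ((a - k) * (n - k)) * qbin a k * qbin b (n - k).
Proof.
elim: a n => [|a IH] n.
  rewrite big_ord_recl /= qbinn sub0n mul0n expr0 !mul1r subn0 big1 ?addr0
    // => k _.
  by rewrite (@qbin_small 0) // mulr0 mul0r.
case: n => [|n]; first by rewrite big_ord1 /= subn0 muln0 expr0 !qbin0 !mul1r.
rewrite addSn qbinS_sym !IH mulr_sumr [in RHS]big_ord_recl /=.
under [X in _ = _ + X]eq_bigr => k _.
  rewrite /bump /= add1n qbinS_sym !subSS mulrDr mulrDl.
  over.
rewrite big_split /= addrA; congr (_ + _).
rewrite big_ord_recl /=; congr (_ + _).
  by rewrite !subn0 !qbin0 !mulr1 !mulrA -exprD; congr (q ^+ _ * _); lia.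
apply: eq_bigr => k _; rewrite /bump /= add1n subSS.
have [lt_ak|le_ka] := ltnP a k.+1; first by rewrite qbin_small // !(mulr0, mul0r).
rewrite !mulrA -!exprD; congr (q ^+ _ * _ * _).
by have := ltn_ord k; nia.
Qed.

(** For [t <= n] both sides are the q-multinomial with parts [s], [t - s], [n - t]. *)
Lemma qbin_trinomial n t s : (s <= t)%N ->
  qbin n t * qbin t s = qbin n s * qbin (n - s) (t - s).
Proof.
move=> le_st; have [lt_nt|le_tn] := ltnP n t.
  rewrite (qbin_small lt_nt) mul0r; have [/qbin_small->|?] := ltnP n s.
    by rewrite mul0r.
  by rewrite (@qbin_small (n - s)) ?mulr0 //; lia.
rewrite /qbin !ifT; [|lia..].
have -> : (n - s - (t - s))%N = (n - t)%N by lia.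
by field; rewrite !qpoch_neq0.
Qed.

(** Three uses of Vandermonde: the first q-binomial, of upper entry [(B - s) + (A + m)], is expanded
    with index [t]; after exchanging the sums, the sum over [s] collapses to [qbin (t + A) (t + d)];
    trinomial revision then leaves a Vandermonde sum over [t] for [B + (m + d)]. *)
Lemma qbin_saalschutz A B m d :
  \sum_(s < m.+1) q ^+ (s * (s + d)) * qbin (A + B + m - s) (m - s)
     * qbin A (s + d) * qbin B s
  = qbin (A + m) (m + d) * qbin (B + m + d) m.
Proof.
have expand (s : 'I_m.+1) :
    q ^+ (s * (s + d)) * qbin (A + B + m - s) (m - s) * qbin A (s + d) * qbin B s
    = \sum_(t < m.+1 | (s <= t)%N) q ^+ ((B - t) * (m - t)) * qbin B t
        * qbin (A + m) (m - t) * (q ^+ (s * (s + d)) * qbin A (s + d) * qbin t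
          (t - s)).
  have [lt_Bs|le_sB] := ltnP B s.
    rewrite (qbin_small lt_Bs) mulr0 big1 // => t le_st.
    by rewrite (@qbin_small B t) ?mulr0 ?mul0r //; lia.
  have le_sm : (s <= m)%N by rewrite -ltnS.
  have -> : (A + B + m - s)%N = ((B - s) + (A + m))%N by lia.
  pose g k := q ^+ ((B - s - k) * (m - s - k)) * qbin (B - s) k
                * qbin (A + m) (m - s - k).
  have -> : qbin (B - s + (A + m)) (m - s) =
      \sum_(t < m.+1 | (s <= t)%N) g (t - s)%N.
    by rewrite big_ord_geq // qbin_vandermonde.
  rewrite mulr_sumr !mulr_suml; apply: eq_bigr => t le_st.
  rewrite /g qbin_sym //.
  have -> : (B - s - (t - s))%N = (B - t)%N by lia.
  have -> : (m - s - (t - s))%N = (m - t)%N by lia.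
  transitivity (q ^+ (s * (s + d)) * q ^+ ((B - t) * (m - t)) * qbin (A + m) (m - t)
     * qbin A (s + d) * (qbin B s * qbin (B - s) (t - s))); first by ring.
  by rewrite -qbin_trinomial //; ring.
under eq_bigr do rewrite expand.
rewrite (exchange_big_dep xpredT) //=.
transitivity (\sum_(t < m.+1) qbin (A + m) (m + d)
    * (q ^+ ((B - t) * (m - t)) * qbin B t * qbin (m + d) (m - t))); last first.
  by rewrite -mulr_sumr -qbin_vandermonde addnA.
apply: eq_bigr => t _; rewrite -mulr_sumr.
have -> : \sum_(s < m.+1 | (s <= t)%N)
    q ^+ (s * (s + d)) * qbin A (s + d) * qbin t (t - s) = qbin (t + A) (t + d).
  have le_tm : (t.+1 <= m.+1)%N by [].
  rewrite -(big_ord_widen _ (fun s => q ^+ (s * (s + d)) * qbin A (s + d) * qbin t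
    (t - s)) le_tm).
  rewrite qbin_vandermonde.
  (* Among the [t + d + 1] Vandermonde terms, those with [k > t] vanish; the rest are matched by
     [k = t - s]. *)
  rewrite (@big_ord_widen_eq0 _ t.+1 (t + d).+1
    (fun k => q ^+ ((t - k) * (t + d - k)) * qbin t k * qbin A (t + d - k)));
      last 2 first.
  - by rewrite ltnS leq_addr.
  - by move=> k ?; rewrite (@qbin_small t) ?mulr0 ?mul0r //; lia.
  rewrite [RHS](reindex_inj rev_ord_inj) /=; apply: eq_bigr => s _.
  have := ltn_ord s => lt_st.
  have -> : (t - (t.+1 - s.+1))%N = s by lia.
  have -> : (t + d - (t.+1 - s.+1))%N = (s + d)%N by lia.
  by rewrite subSS mulrAC.
have le_tm : (t <= m)%N by rewrite -ltnS.
have := @qbin_trinomial (A + m) (m + d) (m - t).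
have -> : (A + m - (m - t))%N = (t + A)%N by lia.
have -> : (m + d - (m - t))%N = (t + d)%N by lia.
move=> E; rewrite -mulrA -E; last by lia.
by ring.
Qed.

End QBinomial.

(** * The Burge transform of the right-hand side *)

Section Burge.
Variables (F : fieldType) (q : F).
Hypothesis q_not_root : forall k : nat, (0 < k)%N -> q ^+ k != 1.

(** Putting [r = s + j] gives the q-Saalschutz sum with [m = M - j] and [d = 2 * j]; the powers of
    [q] agree because [(s + j)^2 = j^2 + s * (s + 2 * j)]. If [A < 0] or [M < j], both sides
    vanish. *)
Lemma burge_nat (A : int) (B j M K : nat) : (M < K)%N ->
  \sum_(r < K) q ^+ (r ^ 2) * qbinom q (A + B%:Z + M%:Z - r%:Z) (M%:Z - r%:Z)
     * qbinom q A (r%:Z + j%:Z) * qbinom q B (r%:Z - j%:Z)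
  = q ^+ (j ^ 2) * qbinom q (A + M%:Z - j%:Z) (M%:Z + j%:Z)
     * qbinom q (B%:Z + M%:Z + j%:Z) (M%:Z - j%:Z).
Proof.
move=> lt_MK; case: (ltP A 0) => [A0|].
  rewrite (qbinom_eq0 q (a := A + _ - _)) ?mulr0 ?mul0r; last by lia.
  by rewrite big1 // => r _; rewrite (qbinom_eq0 q (a := A)) ?mulr0 ?mul0r //; lia.
case: A => // A _; have [lt_Mj|le_jM] := ltnP M j.
  rewrite (qbinom_eq0 q (b := M%:Z - j%:Z)) ?mulr0; last by lia.
  rewrite big1 // => r _; have [?|?] := ltnP r j.
    by rewrite (qbinom_eq0 q (b := r%:Z - j%:Z)) ?mulr0 //; lia.
  by rewrite (qbinom_eq0 q (b := M%:Z - r%:Z)) ?mulr0 ?mul0r //; lia.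
pose f (r : nat) := q ^+ (r ^ 2) * qbinom q (A%:Z + B%:Z + M%:Z - r%:Z)
  (M%:Z - r%:Z)
     * qbinom q A (r%:Z + j%:Z) * qbinom q B (r%:Z - j%:Z).
have f_big r : (M < r)%N -> f r = 0.
  by move=> ?; rewrite /f (qbinom_eq0 q (b := M%:Z - r%:Z)) ?mulr0 ?mul0r //; lia.
rewrite -(@big_ord_shift_eq0 _ K j f); last 2 first.
- by move=> r ?; rewrite /f (qbinom_eq0 q (b := r%:Z - j%:Z)) ?mulr0 //; lia.
- by move=> r ?; apply: f_big; lia.
rewrite (@big_ord_widen_eq0 _ (M - j).+1 K (fun x => f (x + j)%N)); last 2 first.
- by lia.
- by move=> r ?; apply: f_big; lia.
have -> : A%:Z + M%:Z - j%:Z = (A + (M - j))%N by lia.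
have -> : M%:Z + j%:Z = (M - j + 2 * j)%N by lia.
have -> : B%:Z + M%:Z + j%:Z = (B + (M - j) + 2 * j)%N by lia.
have -> : M%:Z - j%:Z = (M - j)%N by lia.
rewrite !qbinom_nat -mulrA -qbin_saalschutz // mulr_sumr.
apply: eq_bigr => s _; have := ltn_ord s => lt_s; rewrite /f.
have -> : A%:Z + B%:Z + M%:Z - (s + j)%N%:Z = (A + B + (M - j) - s)%N by lia.
have -> : M%:Z - (s + j)%N%:Z = (M - j - s)%N by lia.
have -> : (s + j)%N%:Z + j%:Z = (s + 2 * j)%N by lia.
have -> : (s + j)%N%:Z - j%:Z = s by lia.
rewrite !qbinom_nat !mulrA -exprD; congr (q ^+ _ * _ * _ * _); nia.
Qed.

(** Negative [j] reduces to positive [j] by exchanging [A] and [B]. The sign conditions are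
    conditional on [j] because [wsum_burge_step] takes [A = L - (v - 1) * j], which can be negative
    for [j > 0], and symmetrically for [B]. *)
Lemma burge (A B j : int) (M K : nat) : (M < K)%N ->
  (0 <= j -> 0 <= B) -> (j <= 0 -> 0 <= A) ->
  \sum_(r < K) q ^+ (r ^ 2) * qbinom q (A + B + M%:Z - r%:Z) (M%:Z - r%:Z)
     * qbinom q A (r%:Z + j) * qbinom q B (r%:Z - j)
  = q ^+ (`|j| ^ 2) * qbinom q (A + M%:Z - j) (M%:Z + j)
     * qbinom q (B + M%:Z + j) (M%:Z - j).
Proof.
move=> lt_MK; case: (ler0P j) => [j0 _ /(_ isT) A0|j0 /(_ (ltW j0)) B0 _].
  have [jn Ej] : {n : nat | j = - n%:Z} by exists `|j|%N; lia.
  rewrite {}Ej; case: A A0 => // A _; rewrite opprK.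
  rewrite abszN absz_nat mulrAC -(burge_nat _ _ _ lt_MK); apply: eq_bigr => r _.
  by rewrite (addrC B) mulrAC.
by case: B B0 => // B _; case: j j0 => // j _; rewrite burge_nat.
Qed.

(* A sum over the window -K <= j < K, which is stable under j -> -1-j. *)
Definition wsum (K : nat) (f : int -> F) : F := \sum_(x < K.*2) f (x%:Z - K%:Z).

(** This is [rhs_term] for [k = v - i] with both q-binomials reflected, so that the lower entries
    [M + j] and [M - j] do not involve [L]. The recursion replaces [L] by [L - r], hence an
    integer. *)
Definition burge_term (v k : nat) (L : int) (M : nat) (j : int) : F :=
  (-1) ^ j * q ^+ (v * `|j| ^ 2)
  * qbinom q (L + M%:Z - (v%:Z - 1) * j) (M%:Z + j)
  * qbinom q (L + k%:Z + M%:Z + (v%:Z - 1) * j) (M%:Z - j).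

(** If the first q-binomial survives, then [v * j <= L < 0], so [j <= -1] and
    [L + k + v * j <= L < 0], which kills the second. *)
Lemma burge_term_neg v k L M j : (k <= v)%N -> L < 0 -> burge_term v k L M j = 0.
Proof.
move=> le_kv L0; rewrite /burge_term.
have [?|?] := ltP (L - v%:Z * j) 0.
  by rewrite (qbinom_eq0 q (b := M%:Z + j)) ?mulr0 ?mul0r //; lia.
rewrite [X in _ * X]qbinom_eq0 ?mulr0 //.
have : j < 0 by nia.
nia.
Qed.

Lemma wsum_burge_neg K v k L M : (k <= v)%N -> L < 0 ->
  wsum K (burge_term v k L M) = 0.
Proof. by move=> le_kv L0; rewrite /wsum big1 // => x _;
  rewrite burge_term_neg. Qed.

(** Holds for each [j] separately: [r] cancels from the upper entries of the inner summand, and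
    [burge] applies with [A = L - (v - 1) * j] and [B = L + k + (v - 1) * j], whose sum is
    [2 * L + k]. *)
Lemma wsum_burge_step K v k L M : (0 < v)%N -> (k <= v)%N -> (M < K)%N ->
  \sum_(r < K) q ^+ (r ^ 2) * qbinom q (L *+ 2 + k%:Z + M%:Z - r%:Z) (M%:Z - r%:Z)
    * wsum K (burge_term v k (L - r%:Z) r)
  = wsum K (burge_term v.+1 k L M).
Proof.
move=> v0 le_kv lt_MK; have [L0|L0] := ltP L 0.
  rewrite wsum_burge_neg //; last exact: leqW.
  by rewrite big1 // => r _; rewrite wsum_burge_neg ?mulr0 //; lia.
under eq_bigr do rewrite mulr_sumr.
rewrite exchange_big; apply: eq_bigr => x _ /=; move: (x%:Z - K%:Z) => j.
rewrite /burge_term.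
transitivity ((-1) ^ j * q ^+ (v * `|j| ^ 2) *
  (q ^+ (`|j| ^ 2) * qbinom q (L - (v%:Z - 1) * j + M%:Z - j) (M%:Z + j)
    * qbinom q (L + k%:Z + (v%:Z - 1) * j + M%:Z + j) (M%:Z - j))).
  rewrite -(burge lt_MK); [|nia..].
  rewrite mulr_sumr; apply: eq_bigr => r _.
  have -> : L - r%:Z + r%:Z - (v%:Z - 1) * j = L - (v%:Z - 1) * j by lia.
  have -> : L - r%:Z + k%:Z + r%:Z + (v%:Z - 1) * j = L + k%:Z + (v%:Z - 1)
    * j by lia.
  have -> : L - (v%:Z - 1) * j + (L + k%:Z + (v%:Z - 1) * j) = L *+ 2 + k%:Z by lia.
  by ring.
rewrite !mulrA -[(-1) ^ j * _ * _]mulrA -exprD.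
congr (_ * q ^+ _ * qbinom q _ _ * qbinom q _ _); nia.
Qed.

Lemma exprN1z (j : int) : (-1) ^ j = (-1) ^+ `|j|%N :> F.
Proof. by case: j => n //; rewrite NegzE abszN absz_nat -invr_expz -exprVn invrN1. Qed.

(* The terms are paired, since [f = -f] is not enough in characteristic 2. *)
Lemma wsum_antisym K (f : int -> F) : (forall j, f (- 1 - j) = - f j) ->
  wsum K f = 0.
Proof.
move=> f_anti; rewrite /wsum -addnn big_split_ord /=.
rewrite (reindex_inj rev_ord_inj) /= -big_split big1 // => x _ /=.
have := ltn_ord x => lt_xK.
have -> : (K - x.+1)%N%:Z - K%:Z = - 1 - x%:Z by lia.
have -> : (K + x)%N%:Z - K%:Z = x%:Z by lia.
by rewrite f_anti addNr.
Qed.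

(** Pascal's rule on the second q-binomial lowers [k] from [v.+1] to [v] and leaves the remainder
    [D]. The reflection [j -> -1-j] exchanges the two q-binomials of [D] and flips its sign. *)
Lemma wsum_burge_fold K v L M :
  wsum K (burge_term v.+1 v.+1 L M) = wsum K (burge_term v.+1 v L M).
Proof.
have [L0|L0] := ltP L 0; first by rewrite !wsum_burge_neg.
(* The exponent is [v.+1 * j^2] plus the Pascal exponent [L + v.+1 + v.+1 * j]; it depends on [j]
   only through [j * (j + 1)], which the reflection fixes. *)
pose D (j : int) := (-1) ^ j * q ^+ `|(v.+1%:Z * (j * (j + 1)) + L + v.+1%:Z)%R|%N
  * qbinom q (L + M%:Z - v%:Z * j) (M%:Z + j)
  * qbinom q (L + v%:Z + M%:Z + v%:Z * j) (M%:Z - j - 1).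
have D_anti j : D (- 1 - j) = - D j.
  rewrite /D mulrAC !exprN1z -!mulNr.
  have -> : (-1) ^+ `|(- 1 - j)%R|%N = - (-1) ^+ `|j|%N :> F.
    by rewrite -[RHS]mulN1r -exprS -signr_odd -[RHS]signr_odd; congr (_ ^+ _); lia.
  congr (_ * q ^+ absz _ * qbinom q _ _ * qbinom q _ _); lia.
apply/eqP; rewrite -subr_eq0 -sumrB; apply/eqP.
rewrite -[RHS](wsum_antisym K D_anti); apply: eq_bigr => x _.
move: (x%:Z - K%:Z) => j; rewrite /burge_term -mulrBr.
have -> : v.+1%:Z - 1 = v%:Z by lia.
rewrite (qbinom_pascal q_not_root (a := L + v.+1%:Z + M%:Z + v%:Z * j));
  last by nia.
have -> : L + v.+1%:Z + M%:Z + v%:Z * j - 1 = L + v%:Z + M%:Z + v%:Z * j by lia.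
have subK (a b : F) : a + b - a = b by ring.
rewrite subK /D {subK}.
(* When the Pascal exponent is negative its absolute value is wrong, but the q-binomial it
   multiplies is zero. *)
have [?|?] := ltP (L + v.+1%:Z + v.+1%:Z * j) 0.
  by rewrite (qbinom_eq0 q (b := M%:Z - j - 1)) ?mulr0 //; lia.
set e := `|(L + v.+1%:Z + M%:Z + v%:Z * j - (M%:Z - j))%R|%N.
have -> : `|(v.+1%:Z * (j * (j + 1)) + L + v.+1%:Z)%R|%N =
  (v.+1 * `|j| ^ 2 + e)%N by rewrite /e; nia.
by rewrite exprD; ring.
Qed.

End Burge.

(** * The q-binomial theorem, read on polynomial coefficients *)

Section QBinomialTheorem.
Variables (F : fieldType) (q : F).
Hypothesis q_not_root : forall k : nat, (0 < k)%N -> q ^+ k != 1.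

Lemma coef_qbinomial_theorem (c : F) (n k : nat) :
  (\prod_(i < n) (1 + (c * q ^+ i) *: 'X : {poly F}))`_k
  = q ^+ 'C(k, 2) * c ^+ k * qbin q n k.
Proof.
elim: n k => [|n IH] k.
  rewrite big_ord0 coef1; case: k => [|k]; first by rewrite qbinn // !mulr1.
  by rewrite qbin_small // mulr0.
rewrite big_ord_recr /= mulrDr mulr1 -scalerAr coefD coefZ coefMX IH.
case: k => [|k] /=; first by rewrite mulr0 addr0 !qbin0.
rewrite IH qbinS // mulrDr; congr (_ + _).
have [lt_nk|le_kn] := ltnP n k; first by rewrite !qbin_small // !mulr0.
rewrite binS bin1 exprD -{1}(subnKC le_kn) exprD exprS; ring.
Qed.

End QBinomialTheorem.

(** * The base case [v = 1], [k = 0] *)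

Section Seed.
Variables (F : fieldType) (q : F).
Hypothesis q_not_root : forall k : nat, (0 < k)%N -> q ^+ k != 1.

Lemma expr2_not_root k : (0 < k)%N -> (q ^+ 2) ^+ k != 1.
Proof. by move=> k0; rewrite -exprM q_not_root // muln_gt0. Qed.

(** Compares coefficients of ['X^(2M)] in the product of all
    [(1 - q^i X) (1 + q^i X) = 1 - q^(2i) X^2], each side expanded by the q-binomial theorem. *)
Lemma qbin_convolution n M :
  \sum_(k < M.*2.+1) q ^+ ('C(k, 2) + 'C(M.*2 - k, 2)) * (-1) ^+ k
     * qbin q n k * qbin q n (M.*2 - k)
  = q ^+ ('C(M, 2)).*2 * (-1) ^+ M * qbin (q ^+ 2) n M.
Proof.
pose P (c r : F) := \prod_(i < n) (1 + (c * r ^+ i) *: 'X : {poly F}).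
have EP : P (- 1) q * P 1 q = P (- 1) (q ^+ 2) \Po 'X^2.
  rewrite /P -big_split rmorph_prod; apply: eq_bigr => i _ /=.
  rewrite comp_polyD comp_polyZ comp_polyX comp_polyC.
  rewrite mul1r mulN1r scaleNr -subr_sqr expr1n exprZn -exprM mulnC exprM.
  by rewrite mulN1r scaleNr.
have := congr1 (fun p : {poly F} => p`_(M.*2)) EP.
rewrite /= coefM coef_comp_poly_Xn // -muln2 dvdn_mull // mulnK //.
rewrite coef_qbinomial_theorem; last exact: expr2_not_root.
rewrite -exprM => E; rewrite -mul2n -E; apply: eq_bigr => k _.
rewrite !coef_qbinomial_theorem // expr1n exprD; ring.
Qed.

Lemma double_bin2 n : (('C(n, 2)).*2 + n = n ^ 2)%N.
Proof. by elim: n => // n IH; rewrite binS bin1; nia. Qed.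

(** Turns the exponents of the convolution into the [j^2] of [burge_term], with [j = k - M], up to a
    factor independent of [k]. *)
Lemma bin2_sym_sum k M : (k <= M.*2)%N ->
  ('C(k, 2) + 'C(M.*2 - k, 2) = ('C(M, 2)).*2 + `|(k%:Z - M%:Z)%R| ^ 2)%N.
Proof.
move=> le_k.
have := double_bin2 k; have := double_bin2 (M.*2 - k)%N; have := double_bin2 M.
have [le_kM|lt_Mk] := leqP k M.
  have EM : M = (k + (M - k))%N by lia.
  rewrite {le_k le_kM}EM; move: (M - k)%N => d.
  have -> : ((k + d).*2 - k = k + d.*2)%N by lia.
  have -> : `|(k%:Z - (k + d)%N%:Z)%R|%N = d by lia.
  by nia.
have Ek : k = (M + (k - M))%N by lia.
have : (k - M <= M)%N by lia.
rewrite {le_k lt_Mk}Ek; move: (k - M)%N => d le_dM.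
have -> : (M.*2 - (M + d) = M - d)%N by lia.
have -> : `|((M + d)%N%:Z - M%:Z)%R|%N = d by lia.
by nia.
Qed.

Lemma qbin_q0 n k : q = 0 -> (k <= n)%N -> qbin q n k = 1.
Proof.
move=> q0 le_kn; have qpoch1 m : qpoch q m = 1.
  by rewrite q0; elim: m => [|m IH]; rewrite ?qpoch0
    // qpochS IH expr0n subr0 mulr1.
by rewrite /qbin le_kn !qpoch1 mulr1 divr1.
Qed.

End Seed.

Section SeedIdentity.
Variables (F : fieldType) (q : F).
Hypothesis q_not_root : forall k : nat, (0 < k)%N -> q ^+ k != 1.

Lemma wsum_burge_seed K (L : int) (M : nat) : (M < K)%N ->
  wsum K (burge_term q 1 0 L M) = qbinom (q ^+ 2) (L + M%:Z) M%:Z.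
Proof.
move=> lt_MK; have [L0|] := ltP L 0.
  by rewrite wsum_burge_neg // qbinom_eq0 //; lia.
case: L => // L _; set n := (L + M)%N.
have -> : L%:Z + M%:Z = n by [].
rewrite qbinom_nat.
pose f (k : nat) : F := (-1) ^+ (k + M) * q ^+ (`|(k%:Z - M%:Z)%R| ^ 2)
   * qbin q n k * qbin q n (M.*2 - k).
have -> : wsum K (burge_term q 1 0 L M) = \sum_(k < M.*2.+1) f k.
  (* Only [-M <= j <= M] contributes, by the lower entries [M + j] and [M - j]; the new index is
     [k = M + j]. *)
  rewrite /wsum -(@big_ord_shift_eq0 _ _ (K - M) (fun x => burge_term q 1 0 L M
    (x%:Z - K%:Z))).
  - rewrite (@big_ord_widen_eq0 _ M.*2.+1 _
      (fun x => burge_term q 1 0 L M ((x + (K - M))%N%:Z - K%:Z))).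
    + apply: eq_bigr => k _; have := ltn_ord k => lt_k; rewrite /burge_term
      /f exprN1z.
      have -> : (k + (K - M))%N%:Z - K%:Z = k%:Z - M%:Z by lia.
      rewrite subrr !mul0r subr0 !addr0 mul1n.
      have -> : M%:Z + (k%:Z - M%:Z) = k by lia.
      have -> : M%:Z - (k%:Z - M%:Z) = (M.*2 - k)%N by lia.
      have -> : L%:Z + M%:Z = n by [].
      rewrite !qbinom_nat -signr_odd -[in RHS]signr_odd; congr (_ ^+ _ * _ * _
        * _); lia.
    + by lia.
    + move=> x ?; rewrite /burge_term [X in _ * X]qbinom_eq0 ?mulr0 //; lia.
  - by move=> r ?; rewrite /burge_term (qbinom_eq0 q
    (b := M%:Z + _)) ?mulr0 ?mul0r //; lia.
  - by move=> r ?; rewrite /burge_term [X in _ * X]qbinom_eq0 ?mulr0 //; lia.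
have le_Mn : (M <= n)%N by rewrite leq_addl.
(* The value [q = 0] is allowed, but then the power of [q] cancelled below may be zero; in this case
   only [k = M] contributes. *)
have [q0|qn0] := eqVneq q 0.
  have lt_M : (M < M.*2.+1)%N by lia.
  rewrite (bigD1 (Ordinal lt_M)) //= big1 => [|k /eqP/val_eqP /= neq_k]; last first.
    rewrite /f q0 expr0n; case: eqP => [|_]; last by rewrite mulr0 !mul0r.
    by move/eqP; rewrite expn_eq0; lia.
  rewrite addr0 /f subrr -[M.*2]addnn addnK absz0 expr0 mulr1 !qbin_q0 ?expr2 ?q0 ?mul0r //.
  by rewrite addnn -signr_odd odd_double !mulr1.
have c0 : q ^+ ('C(M, 2)).*2 * (-1) ^+ M != 0 by rewrite mulf_neq0 ?expf_neq0 ?oppr_eq0 ?oner_eq0.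
apply: (mulfI c0); rewrite -qbin_convolution // mulr_sumr; apply: eq_bigr => k _.
rewrite /f bin2_sym_sum; last by rewrite -ltnS.
rewrite [in RHS]exprD.
transitivity (q ^+ ('C(M, 2)).*2 * q ^+ (`|(k%:Z - M%:Z)%R| ^ 2) *
  ((-1) ^+ M * (-1) ^+ (k + M)) * qbin q n k * qbin q n (M.*2 - k)); first by ring.
congr (_ * _ * _ * _); rewrite -exprD -signr_odd -[in RHS]signr_odd; congr
  (_ ^+ _); lia.
Qed.

End SeedIdentity.

(** * The left-hand side, summed along the Burge recursion *)

Fixpoint bounded_seqs (m K : nat) : seq (seq nat) :=
  if m is m'.+1 then [seq x :: s | x <- iota 0 K, s <- bounded_seqs m' K]
  else [:: [::]].

Lemma mem_bounded_seqs m K s :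
  (s \in bounded_seqs m K) = (size s == m) && all (fun x => x < K)%N s.
Proof.
elim: m s => [|m IH] s /=; first by rewrite inE; case: s.
apply/allpairsP/idP => [[[x t] /= [xK tK ->]]|].
  by move: xK tK; rewrite mem_iota IH /= eqSS => -> /andP[-> ->].
case: s => // x t /= /andP[st /andP[xK tK]].
by exists (x, t); rewrite mem_iota IH -eqSS st xK tK.
Qed.

Lemma bounded_seqs_uniq m K : uniq (bounded_seqs m K).
Proof.
elim: m => //= m IH; apply: allpairs_uniq => //; first exact: iota_uniq.
by move=> [x s] [y t] _ _ [-> ->].
Qed.

Section Chain.
Variables (F : fieldType) (q : F).
Hypothesis q_not_root : forall k : nat, (0 < k)%N -> q ^+ k != 1.

(* [burge_chain k L M [:: n_1; ...; n_(v-1)]] is the left-hand summand for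
   k = v - i, unfolded along the Burge recursion; [sumn s] is N_1. *)
Fixpoint burge_chain (k : nat) (L : int) (M : nat) (s : seq nat) : F :=
  if s is _ :: s' then
    q ^+ (sumn s ^ 2)
    * qbinom q (L *+ 2 + k%:Z + M%:Z - (sumn s)%:Z) (M%:Z - (sumn s)%:Z)
    * burge_chain (minn k (size s')) (L - (sumn s)%:Z) (sumn s) s'
  else qbinom (q ^+ 2) (L + M%:Z) M%:Z.

Lemma burge_chain_eq0 k L M s : (M < sumn s)%N -> burge_chain k L M s = 0.
Proof.
by case: s => // x s; rewrite /= => ?; rewrite (qbinom_eq0 q
  (b := M%:Z - _)) ?mulr0 ?mul0r //; lia.
Qed.

(** Induction on [m]: the sum over the tail is evaluated first, at fixed [r], and [wsum_burge_step]
    then sums over [r]. The bound [r < K] supplies the hypothesis on [M] at the next level. *)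
Lemma sum_burge_chain K m k L M : (k <= m)%N -> (M < K)%N ->
  \sum_(s <- bounded_seqs m K) burge_chain k L M s = wsum K
    (burge_term q m.+1 k L M).
Proof.
elim: m k L M => [|m IH] k L M le_km lt_MK.
  by move: le_km; rewrite leqn0 => /eqP->; rewrite big_seq1 /= wsum_burge_seed.
rewrite /= big_allpairs_dep exchange_big /=.
pose h (s : seq nat) (r : nat) := q ^+ (r ^ 2)
  * qbinom q (L *+ 2 + k%:Z + M%:Z - r%:Z) (M%:Z - r%:Z)
  * burge_chain (minn k (size s)) (L - r%:Z) r s.
(* The head n_1 is traded for [r = n_1 + sumn s]. The added terms [r < sumn s] vanish by
   [burge_chain_eq0], the dropped ones [r >= K] because [r > M]. *)
have shift s : \sum_(x <- iota 0 K) burge_chain k L M (x :: s) = \sum_(r < K) h s r.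
  rewrite -(@big_ord_shift_eq0 _ K (sumn s) (h s)).
  - by rewrite -(big_mkord xpredT (fun x => h s (x + sumn s)%N)) /index_iota subn0.
  - by move=> r lt_r; rewrite /h burge_chain_eq0 ?mulr0.
  - move=> r le_r; rewrite /h (qbinom_eq0 q (b := M%:Z - r%:Z)) ?mulr0 ?mul0r //;
    lia.
under eq_bigr do rewrite shift.
rewrite exchange_big -wsum_burge_step //; apply: eq_bigr => r _ /=.
rewrite -mulr_sumr; congr (_ * _).
(* The minimum changes [k] only when [k = m.+1], which is the case covered by folding. *)
have -> : wsum K (burge_term q m.+1 k (L - r%:Z) r) =
    wsum K (burge_term q m.+1 (minn k m) (L - r%:Z) r).
  have [->|neq_km] := eqVneq k m.+1.
    by rewrite wsum_burge_fold // (minn_idPr (leqnSn m)).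
  by have -> : minn k m = k by lia.
rewrite -IH ?geq_minr //; apply: eq_big_seq => s; rewrite mem_bounded_seqs.
by case/andP => /eqP->.
Qed.

Lemma burge_chain_cons k L M x s (r := sumn (x :: s)) :
  burge_chain k L M (x :: s) = q ^+ (r ^ 2)
  * qbinom q (L *+ 2 + k%:Z + M%:Z - r%:Z) (M%:Z - r%:Z)
  * burge_chain (minn k (size s)) (L - r%:Z) r s.
Proof. by []. Qed.

Lemma burge_chainE k L M s : (0 < size s)%N ->
  let N j := sumn (drop j s) in
  burge_chain k L M s = q ^+ (\sum_(0 <= j < size s) N j ^ 2)%N
  * qbinom q (L *+ 2 + k%:Z + M%:Z - (N 0)%:Z) (M%:Z - (N 0)%:Z)
  * qbinom (q ^+ 2) (L - \sum_(0 <= t < (size s).-1) (N t)%:Z)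
      (nth 0%N s (size s).-1)%:Z
  * \prod_(0 <= j < (size s).-1)
      qbinom q ((nth 0%N s j)%:Z + L *+ 2 - 2 * (\sum_(0 <= t < j.+1) (N t)%:Z)
                + (minn k ((size s).-1 - j))%:Z) (nth 0%N s j)%:Z.
Proof.
elim: s k L M => // x s IH k L M _ N; case Es: (size s) => [|m].
  rewrite (size0nil Es) in @N *.
  by rewrite /= !big_nat1 !big_geq // mulr1 subr0 /N /= addn0 subrK.
rewrite burge_chain_cons {}IH Es //.
have -> : size (x :: s) = m.+2 by rewrite /= Es.
rewrite [m.+2.-1]/= [m.+1.-1]/= [in RHS]big_nat_recl // exprD.
rewrite [X in _ = _ * qbinom _ (_ - X) _ * _]big_nat_recl //.
rewrite [X in _ = _ * X]big_nat_recl //.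
rewrite /N big_nat1 !drop0 subn0.
rewrite [X in qbinom (q ^+ 2) (L - X) _]/= opprD addrA.
set c := qbinom (q ^+ 2) _ _.
have -> : \prod_(0 <= j < m) qbinom q ((nth 0%N s j)%:Z + (L - (sumn
  (x :: s))%:Z) *+ 2
      - 2 * (\sum_(0 <= t < j.+1) (sumn (drop t s))%:Z) + (minn (minn k m.+1)
        (m - j))%:Z) (nth 0%N s j)%:Z
   = \prod_(0 <= j < m) qbinom q ((nth 0%N (x :: s) j.+1)%:Z + L *+ 2
      - 2 * (\sum_(0 <= t < j.+2) (sumn (drop t (x :: s)))%:Z)
      + (minn k (m.+1 - j.+1))%:Z) (nth 0%N (x :: s) j.+1)%:Z.
  apply: eq_big_nat => j lt_j; congr (qbinom _ _ _).
  (* Nested minima collapse: the outer cap [m.+1] is weaker than the inner cap [m - j]. *)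
  rewrite [in RHS]big_nat_recl // drop0 -minnA.
  have -> : minn m.+1 (m - j) = (m.+1 - j.+1)%N by lia.
  by rewrite /=; move: (\sum_(_ <= _ < _) _) => S; lia.
set p := \prod_(_ <= _ < _) _.
(* Since N_1 - N_2 = n_1, the leading q-binomial of the inner chain is the factor [j = 0] of the
   product. *)
have -> : (L - (sumn (x :: s))%:Z) *+ 2 + (minn k m.+1)%:Z + (sumn (x :: s))%:Z
    - (sumn s)%:Z = x%:Z + L *+ 2 - 2 * (sumn (x :: s))%:Z + (minn k m.+1)%:Z.
  by rewrite /=; lia.
have -> : (sumn (x :: s))%:Z - (sumn s)%:Z = x%:Z by rewrite /=; lia.
rewrite [nth _ _ 0]/=.
by ring.
Qed.

End Chain.

(** * Translation to the notation of the statement, and conclusion *)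

Lemma nsumS v (n : v.-1.-tuple nat) j : nsum n j.+1 = sumn (drop j n).
Proof.
rewrite /nsum big_add1 sumnE [RHS](big_nth 0%N) size_drop size_tuple.
rewrite -[X in (\sum_(X <= _ < _) _)%N]add0n big_addn.
by apply: eq_bigr => t _; rewrite /ncoord /= nth_drop addnC.
Qed.

Lemma lhs_termE (F : fieldType) (q : F) (v i L M : nat) (n : v.-1.-tuple nat) :
  (2 <= v)%N -> lhs_term q i L M n = burge_chain q (v - i) L M n.
Proof.
move=> hv; have sn : size n = v.-1 by rewrite size_tuple.
rewrite burge_chainE sn; last by lia.
rewrite /lhs_term !big_add1 nsumS; congr (_ * _ * _ * _).
- by congr (q ^+ _); apply: eq_bigr => j _; rewrite nsumS.
- by congr (qbinom _ (_ - _) _); lia.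
- by congr (qbinom _ (_ - _) _); apply: eq_bigr => j _; rewrite nsumS.
- apply: eq_bigr => j _; congr (qbinom _ _ _).
  rewrite big_add1 /=; under eq_bigr do rewrite nsumS.
  by move: (\sum_(_ <= _ < _) _) => S; rewrite /ncoord /=; lia.
Qed.

Lemma rhs_termE (F : fieldType) (q : F) (v i L M : nat) (j : int) :
  (i <= v)%N -> rhs_term q v i L M j = burge_term q v (v - i) L M j.
Proof.
move=> le_iv; rewrite /rhs_term /burge_term.
have -> : v%:Z * j ^+ 2 = (v * `|j| ^ 2)%N by nia.
rewrite -exprnP (qbinom_sym q (_ + M%:Z - _)) [X in _ * X = _]qbinom_sym.
by congr (_ * _ * qbinom q _ _ * qbinom q _ _); lia.
Qed.

Theorem theorem5p4 (F : fieldType) (q : F)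
    (hq : forall k : nat, (0 < k)%N -> q ^+ k != 1)
    (v i L M : nat) (hv : (2 <= v)%N) (hi : (1 <= i <= v)%N) :
  \sum_(n \in [set: v.-1.-tuple nat]) lhs_term q i L M n =
  \sum_(j \in [set: int]) rhs_term q v i L M j.
Proof.
have /andP[i_gt0 le_iv] := hi.
have lt_k : (v - i <= v.-1)%N by lia.
transitivity (wsum M.+1 (burge_term q v (v - i) L M)).
  have -> : burge_term q v = burge_term q v.-1.+1 by rewrite prednK //; lia.
  rewrite -sum_burge_chain //.
  under eq_fsbigr do rewrite lhs_termE //.
  rewrite -(@reindex_fsbig _ _ _ _ _ (@tval v.-1 nat) setT [set s | size s = v.-1]
    (burge_chain q (v - i) L M)); last first.
    split=> [t _ /=|s t _ _ /val_inj //|s /= ss]; first exact: size_tuple.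
    by exists (tcast ss (in_tuple s)) => //; rewrite val_tcast.
  rewrite (fsbigE (bounded_seqs v.-1 M.+1)).
  - rewrite big_seq_cond [RHS]big_seq; apply: eq_bigl => s.
    by rewrite mem_bounded_seqs; case: eqP => //= ss; rewrite mem_set ?andbT.
  - exact: bounded_seqs_uniq.
  - by move=> s /=; rewrite mem_bounded_seqs => /andP[/eqP].
  (* A sequence outside the list has an entry above [M], so N_1 exceeds [M] and its term is zero. *)
  - move=> s /= ss; rewrite mem_bounded_seqs ss eqxx /= => /allPn[x xs].
    rewrite -leqNgt => le_Mx; apply: burge_chain_eq0; apply: leq_trans le_Mx _.
    by rewrite sumnE (big_rem x) //= leq_addr.
under eq_fsbigr do rewrite rhs_termE //.
(* The window [-M-1 <= j < M+1] contains the support, which lies in [-M <= j <= M]. *)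
apply/esym; rewrite (fsbigE [seq x%:Z - M.+1%:Z | x <- iota 0 M.+1.*2]) //.
- under eq_bigl do rewrite in_setT.
  by rewrite big_map /wsum -(big_mkord xpredT (fun x : nat => burge_term q v
    (v - i) L M (x%:Z - M.+1%:Z))) /index_iota subn0.
- by rewrite map_inj_uniq ?iota_uniq // => x y; lia.
- move=> j _ jN; have [lt_j|le_j] := ltP (M%:Z + j) 0.
    by rewrite /burge_term (qbinom_eq0 q (b := M%:Z + j)) ?mulr0 ?mul0r ?lt_j ?orbT.
  rewrite /burge_term [X in _ * X]qbinom_eq0 ?mulr0 // ltNge.
  apply/orP; left; apply/orP; right; apply/negP => le_Mj; move/negP: jN; apply.
  apply/mapP; exists `|(j + M.+1%:Z)%R|%N; last by lia.
  by rewrite mem_iota; lia.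
Qed.
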